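(* Let $R$ be a tournament on $[n]=\{1,\dots,n\}$. Then there exist independent, proper, continuous random variables $X_1,\dots,X_n$ on the unit interval such that for all $i,j\in[n]$, $$P(X_i>X_j)>\tfrac12 \iff (i,j)\in R .$$
   Context: A tournament on a set $I$ is a subset $R\subset I\times I$ containing no pair $(i,i)$ such that for every pair of distinct $i,j\in I$ exactly one of $(i,j),(j,i)$ lies in $R$. A continuous random variable on the unit interval is a random variable $X$ whose distribution function $F$ is continuous and strictly increasing on $[0,1]$ with $F(0)=0$ and $F(1)=1$. Such an $X$ is proper if $E(X)=\tfrac12$. *)

(* Defs.v *)
From HB Require Import structures.
From mathcomp Require Import all_boot all_order all_algebra.
From mathcomp Require Import all_classical all_reals all_analysis.
Set Implicit Arguments. Unset Strict Implicit. Unset Printing Implicit Defensive.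
Import Order.TTheory GRing.Theory Num.Theory numFieldTopology.Exports.
Local Open Scope classical_set_scope.
Local Open Scope ring_scope.

Definition tournament (I : eqType) (R : rel I) : Prop :=
  (forall i, ~~ R i i) /\ (forall i j, i != j -> R i j (+) R j i).

Definition distr_fun d (T : measurableType d) (R : realType)
  (P : probability T R) (X : {RV P >-> R}) (x : R) : R := fine (cdf X x).

Definition continuous_unit_rv d (T : measurableType d) (R : realType)
  (P : probability T R) (X : {RV P >-> R}) : Prop :=
  let F := distr_fun X in
  continuous F /\
  {in `[0, 1] &, forall x y, x < y -> F x < F y} /\
  F 0 = 0 /\ F 1 = 1.

Definition proper_rv d (T : measurableType d) (R : realType)
  (P : probability T R) (X : {RV P >-> R}) : Prop :=
  ('E_P[X] = (2^-1 : R)%:E)%E.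

Definition mutually_independent d (T : measurableType d) (R : realType)
  (P : probability T R) (I : finType) (X : I -> {RV P >-> R}) : Prop :=
  forall (J : {set I}) (B : I -> set R),
    (forall i, measurable (B i)) ->
    P (\big[setI/setT]_(i in J) (X i @^-1` B i)) =
    (\prod_(i in J) P (X i @^-1` B i))%E.

(* Main.v *)
Require Import Defs.
From HB Require Import structures.
From mathcomp Require Import all_boot all_order all_algebra.
From mathcomp Require Import all_classical all_reals all_analysis.
From mathcomp Require Import measurable_realfun.
From mathcomp Require Import lra ring.
Import Order.TTheory GRing.Theory Num.Theory numFieldTopology.Exports.
Local Open Scope classical_set_scope.
Local Open Scope ring_scope.

Set Implicit Arguments. Unset Strict Implicit.

(* Take X_i with density 1 + g_i / 4 on [0, 1], where g_i is orthogonal to 1 and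
   to x.  Then E X_i = 1/2 and P(X_i > X_j) = 1/2 + A(g_i, g_j) / 16, with
   A(g, h) the integral over y < x of g(x) h(y), a nondegenerate alternating
   form.  Given a family e_k, f_k with A(e_i, f_j) = - s [i = j] (s > 0) and
   A(e_i, e_j) = A(f_i, f_j) = 0, the choice g_i = e_i + sum_(k : i -> k) f_k
   yields A(g_i, g_j) = s if i beats j and - s if j beats i.  Here e_k and f_k
   are step functions supported on the k-th of n blocks of four cells. *)

(** * Ramps, and measures and integrals on a single interval *)

Section ramp.
Context (R : realType).
Implicit Types (t : R) (m : nat).

Definition ramp (t : R) : R := Num.min 1 (Num.max 0 t).

(** [ramp (t - k%:R)] is the length of the part of [k, k + 1] below [t], and these unit cells tile
    [0, m]. The induction is on the sum truncated at [k], where [t] may lie beyond the last cell. *)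
Lemma sum_ramp m t : 0 <= t -> t <= m%:R -> \sum_(k < m) ramp (t - k%:R) = t.
Proof.
move=> t0 tm.
suff H k : \sum_(i < k) ramp (t - i%:R) = Num.min k%:R t.
  by rewrite H /Num.min; case: ltP => //; lra.
elim: k => [|k IH]; first by rewrite big_ord0 /Num.min; case: ltP => //; lra.
have k0 : 0 <= k%:R :> R by [].
rewrite big_ord_recr/= IH /ramp /Num.min /Num.max -natr1.
by case: (ltP 0 (t - _)) => ?; repeat case: ltP => ?; lra.
Qed.

Lemma ramp_le (s t : R) : s <= t -> ramp s <= ramp t.
Proof.
rewrite /ramp /Num.min /Num.max => ?.
by case: (ltP 0 s) => ?; case: (ltP 0 t) => ?; repeat case: ltP => ?; lra.
Qed.

Lemma continuous_ramp : continuous ramp.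
Proof.
move=> x; apply: continuous_min; first exact: cvg_cst.
by apply: continuous_max; [exact: cvg_cst|exact: cvg_id].
Qed.

Lemma ramp0 t : t <= 0 -> ramp t = 0.
Proof.
rewrite /ramp /Num.min /Num.max => ?.
by case: (ltP 0 t) => ?; repeat case: ltP => ?; lra.
Qed.

Lemma ramp1 t : 1 <= t -> ramp t = 1.
Proof.
rewrite /ramp /Num.min /Num.max => ?.
by case: (ltP 0 t) => ?; repeat case: ltP => ?; lra.
Qed.

Lemma ramp_id t : 0 <= t -> t <= 1 -> ramp t = t.
Proof.
rewrite /ramp /Num.min /Num.max => ? ?.
by case: (ltP 0 t) => ?; repeat case: ltP => ?; lra.
Qed.

End ramp.

Lemma integral_affine (R : realType) (a b c e : R) : a < b ->
  (\int[lebesgue_measure]_(x in `[a, b]) (c * x + e)%:E =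
   (c / 2 * (b ^+ 2 - a ^+ 2) + e * (b - a))%:E)%E.
Proof.
move=> ab; pose F (x : R) := c / 2 * x ^+ 2 + e * x.
have dF (x : R) : is_derive x 1 F (c * x + e).
  by apply: is_derive_eq; rewrite /GRing.scale/=; field.
have cF (x : R) : {for x, continuous F}.
  exact/differentiable_continuous/derivable1_diffP.
rewrite (@continuous_FTC2 _ (fun x => c * x + e) F)//.
- by rewrite -EFinD /F; congr EFin; field.
- apply: continuous_subspaceT => x; apply: cvgD; last exact: cvg_cst.
  by apply: cvgM; [exact: cvg_cst|exact: cvg_id].
- split => //.
  + apply: cvg_at_right_filter; exact: cF.
  + apply: cvg_at_left_filter; exact: cF.
- by move=> x _; rewrite derive1E; apply: derive_val.
Qed.

(** The ramp is the fraction of [a, b] lying below [x]. The side [s] covers closed rays, needed for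
    distribution functions, and open rays, needed for strict comparison of two variables. *)
Lemma lebesgue_measure_cell (R : realType) (a b x : R) (s : bool) : a < b ->
  lebesgue_measure ([set` Interval -oo%O (BSide s x)] `&` `[a, b]%classic) =
  ((b - a) * ramp ((x - a) / (b - a)))%:E.
Proof.
move=> ab; have ba : 0 < b - a by rewrite subr_gt0.
have [xa|ax] := ltP x a.
  rewrite ramp0 ?mulr0; last by rewrite pmulr_lle0 ?invr_gt0// subr_le0 ltW.
  rewrite (_ : _ `&` _ = set0) ?measure0//; apply/seteqP; split => // y /=.
  by rewrite !in_itv/=; case: s => /=; lra.
have [bx|xb] := ltP b x.
  rewrite ramp1 ?mulr1; last by rewrite ler_pdivlMr// mul1r lerD2r ltW.
  rewrite (_ : _ `&` _ = `[a, b]%classic).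
    by rewrite lebesgue_measure_itv/= lte_fin ab.
  by apply/seteqP; split => y /=; rewrite !in_itv/=; case: s => /=; lra.
rewrite ramp_id; first last.
- by rewrite ler_pdivrMr// mul1r lerD2r.
- by rewrite divr_ge0 ?subr_ge0// ltW.
rewrite mulrC divfK ?gt_eqF//.
rewrite (_ : _ `&` _ = [set` Interval (BLeft a) (BSide s x)]).
  rewrite lebesgue_measure_itv/= lte_fin; case: ltP => // xa.
  have -> : x = a by lra.
  by rewrite subrr.
by apply/seteqP; split => y /=; rewrite !in_itv/=; case: s => /=; lra.
Qed.

(** * Distribution functions of step densities on m equal cells of [0, 1] *)

Definition step_cdf (R : realType) (m : nat) (v : nat -> R) (x : R) : R :=
  (\sum_(a < m) v a * ramp (x * m%:R - a%:R)) / m%:R.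

Section step_cdf.
Context (R : realType) (m : nat) (v : nat -> R).

Lemma continuous_step_cdf : continuous (step_cdf m v).
Proof.
suff H k (c : R) : continuous (fun x : R => \sum_(a < k) v a * ramp (x * c - a%:R)).
  by move=> x; apply: cvgM; [exact: H|exact: cvg_cst].
elim: k => [|k IH] x.
  rewrite (_ : (fun _ => _) = cst 0); first exact: cvg_cst.
  by apply/funext => y; rewrite big_ord0.
rewrite (_ : (fun _ => _) = fun y : R => \sum_(a < k) v a * ramp (y * c - a%:R) +
    v k * ramp (y * c - k%:R)); last by apply/funext => y; rewrite big_ord_recr.
apply: cvgD; first exact: IH.
apply: cvgM; first exact: cvg_cst.
apply: (@continuous_comp _ _ _ (fun y : R => y * c - k%:R) (@ramp R)).
  apply: cvgB; last exact: cvg_cst.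
  by apply: cvgM; [exact: cvg_id|exact: cvg_cst].
exact: continuous_ramp.
Qed.

Lemma step_cdf0 : step_cdf m v 0 = 0.
Proof.
rewrite /step_cdf big1 ?mul0r// => a _.
by rewrite ramp0 ?mulr0// mul0r sub0r oppr_le0.
Qed.

Hypothesis m0 : (0 < m)%N.

Lemma step_cdf1 : \sum_(a < m) v a = m%:R -> step_cdf m v 1 = 1.
Proof.
move=> vm; rewrite /step_cdf (eq_bigr (fun a : 'I_m => v a)) => [|a _].
  by rewrite vm divff// pnatr_eq0 -lt0n.
by rewrite ramp1 ?mulr1// mul1r lerBrDr addrC natr1 ler_nat.
Qed.

(** Increments dominate those for the constant weight [c], which [sum_ramp] evaluates: F(y) - F(x)
    is at least c (y - x). *)
Lemma step_cdf_increasing (c : R) : 0 < c -> (forall a, c <= v a) ->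
  {in `[0, 1] &, forall x y, x < y -> step_cdf m v x < step_cdf m v y}.
Proof.
move=> c0 cv x y; rewrite !in_itv/= => /andP[x0 x1] /andP[y0 y1] xy.
have mR : 0 < m%:R :> R by rewrite ltr0n.
rewrite /step_cdf ltr_pM2r ?invr_gt0// -subr_gt0 -sumrB.
apply: (@lt_le_trans _ _ (c * (y * m%:R - x * m%:R))).
  by rewrite mulr_gt0// subr_gt0 ltr_pM2r.
have tE t : 0 <= t -> t <= 1 -> t * m%:R = \sum_(a < m) ramp (t * m%:R - a%:R).
  by move=> t0 t1; rewrite sum_ramp// ?mulr_ge0// ler_piMl// ltW.
rewrite [in leLHS]tE// [X in _ * (_ - X)]tE// -sumrB mulr_sumr.
apply: ler_sum => a _; rewrite -mulrBr.
apply: ler_wpM2r; last exact: cv.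
by rewrite subr_ge0 ramp_le// lerD2r ler_pM2r// ltW.
Qed.

End step_cdf.

(* [lebesgue_measure] and [uniform_prob] live on [measurableTypeR R], whose
   display differs from that of the canonical measurable structure on [R]. *)
Definition to_realType (R : realType) : measurableTypeR R -> R := idfun.

Lemma measurable_to_realType (R : realType) :
  measurable_fun setT (@to_realType R).
Proof. by move=> _ A mA; rewrite setTI. Qed.

HB.instance Definition _ (R : realType) :=
  isMeasurableFun.Build _ _ _ _ (@to_realType R) (@measurable_to_realType R).

(** * Laws with step densities: rays, means, comparison of two laws *)

Section step_law.
Context (R : realType) (m : nat) (v : nat -> R).
Hypotheses (m0 : (0 < m)%N) (v0 : forall a, 0 <= v a).
Hypothesis vm : \sum_(a < m) v a = m%:R.

Local Notation leb := (@lebesgue_measure R).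

Let mR : 0 < m%:R :> R. Proof. by rewrite ltr0n. Qed.
Let mN0 : m%:R != 0 :> R. Proof. by rewrite gt_eqF. Qed.

Let cell_lt a : a%:R / m%:R < a.+1%:R / m%:R :> R.
Proof. by rewrite ltr_pM2r ?invr_gt0// ltr_nat. Qed.

Let cell_width a : a.+1%:R / m%:R - a%:R / m%:R = m%:R^-1 :> R.
Proof. by rewrite -natr1; field. Qed.

Local Notation cell a := `[a%:R / m%:R, a.+1%:R / m%:R]%classic.

(** The step density is realized as a convex combination of uniform laws on the cells, with weights
    [v a / m%:R]. *)
Definition mixture :=
  msum (fun a => mscale (NngNum (divr_ge0 (v0 a) (ler0n R m)))
    (uniform_prob (cell_lt a))) m.

HB.instance Definition _ := Measure.on mixture.

Let mixtureT : mixture setT = 1%E.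
Proof.
rewrite /mixture /msum/=.
under eq_bigr do rewrite /mscale/= probability_setT mule1.
by rewrite sumEFin -mulr_suml vm divff.
Qed.

HB.instance Definition _ := Measure_isProbability.Build _ _ _ mixture mixtureT.

Definition step_law : probability (R : measurableType _) R :=
  distribution (mixture : probability _ R) (@to_realType R).

(** The uniform density m on a cell of width 1/m cancels the m in the mixture weight. *)
Lemma integral_step_law (f : R -> \bar R) : measurable_fun setT f ->
  (forall x, 0 <= f x)%E ->
  (\int[step_law]_x f x = \sum_(a < m) (v a)%:E * \int[leb]_(x in cell a) f x)%E.
Proof.
move=> mf f0; rewrite ge0_integral_distribution//=.
have mf' : measurable_fun setT (f \o @to_realType R).
  exact: measurableT_comp mf (@measurable_to_realType R).
rewrite ge0_integral_measure_sum//.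
apply: eq_bigr => a _; rewrite ge0_integral_mscale// integral_uniform//=.
by rewrite cell_width invrK muleA -EFinM divfK.
Qed.

Lemma step_law_itv (s : bool) (x : R) :
  step_law [set` Interval -oo%O (BSide s x)] = (step_cdf m v x)%:E.
Proof.
set I := [set` _]; have mI : measurable I by exact: measurable_itv.
rewrite /step_cdf -(setIT I) -integral_indic// integral_step_law//.
- rewrite mulr_suml -sumEFin; apply: eq_bigr => a _.
  rewrite integral_indic//= lebesgue_measure_cell//.
  rewrite cell_width -EFinM mulrA mulrAC; congr (_ * ramp _ * _)%:E.
  by field.
- exact/measurable_EFinP/measurable_indic.
Qed.

(** For [t] in cell [a], earlier ramps have saturated at 1 and later ones are still 0, so the
    distribution function is affine on each cell. *)
Lemma weighted_ramp_sum (t : R) a : (a < m)%N -> a%:R <= t -> t <= a.+1%:R ->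
  \sum_(b < m) v b * ramp (t - b%:R) = \sum_(b < a) v b + v a * (t - a%:R).
Proof.
(* Induction on the number of cells after the [a]-th. *)
move=> am at_ ta; rewrite -(subnKC am); elim: (_ - _)%N => [|k IH].
  rewrite addn0 big_ord_recr/= ramp_id ?subr_ge0//; last first.
    by rewrite lerBlDr addrC natr1.
  congr (_ + _); apply: eq_bigr => b _; rewrite ramp1 ?mulr1//.
  by rewrite lerBrDr addrC natr1 (le_trans _ at_)// ler_nat.
rewrite addnS big_ord_recr/= IH ramp0 ?mulr0 ?addr0//.
by rewrite subr_le0 (le_trans ta)// ler_nat leq_addr.
Qed.

(** The negative part vanishes because every cell lies in the nonnegative reals; each cell then
    contributes its mass times its midpoint. *)
Lemma step_law_mean :
  (\int[step_law]_x (EFin ^\+ x) - \int[step_law]_x (EFin ^\- x) =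
   ((\sum_(a < m) v a * (a%:R + 2^-1)) / m%:R ^+ 2)%:E)%E.
Proof.
have mE : measurable_fun [set: R] (@EFin R) by exact/measurable_EFinP.
rewrite !integral_step_law//; [|exact: measurable_funeneg|exact: measurable_funepos].
have c0 a (x : R) : x \in cell a -> 0 <= x.
  rewrite inE/= in_itv/= => /andP[+ _]; apply: le_trans.
  by rewrite divr_ge0.
rewrite [X in (_ - X)%E]big1 ?sube0; last first.
  move=> a _; rewrite (eq_integral (cst 0)) ?integral0 ?mule0// => x /c0 x0.
  by rewrite funenegE; apply/max_idPr; rewrite lee_fin oppr_le0.
rewrite mulr_suml -sumEFin; apply: eq_bigr => a _.
transitivity ((v a)%:E * \int[leb]_(x in cell a) (1 * x + 0)%:E)%E.
  congr (_ * _)%E; apply: eq_integral => x /c0 x0.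
  by rewrite funeposE mul1r addr0; apply/max_idPl; rewrite lee_fin.
rewrite integral_affine// -EFinM; congr EFin.
by rewrite -natr1; field.
Qed.

End step_law.

Section two_step_laws.
Context (R : realType) (m : nat) (v w : nat -> R) (m0 : (0 < m)%N).
Hypotheses (v0 : forall a, 0 <= v a) (vm : \sum_(a < m) v a = m%:R).
Hypotheses (w0 : forall a, 0 <= w a) (wm : \sum_(a < m) w a = m%:R).

Local Notation cell a := `[a%:R / m%:R, a.+1%:R / m%:R]%classic.

(** The left side is P(Y < X) for independent X, Y with weights [v], [w]. On a cell the distribution
    function of Y is affine, so its average there is its value at the midpoint, whence the term
    [w a / 2]. *)
Lemma step_law_order :
  (\int[step_law m0 v0 vm]_x step_law m0 w0 wm `]-oo, x[%classic =
   ((\sum_(a < m) v a * (\sum_(b < a) w b + w a / 2)) / m%:R ^+ 2)%:E)%E.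
Proof.
have mN0 : m%:R != 0 :> R by rewrite pnatr_eq0 -lt0n.
have mR : 0 < m%:R :> R by rewrite ltr0n.
under eq_integral do rewrite step_law_itv /step_cdf.
rewrite integral_step_law; first last.
- move=> x; rewrite lee_fin divr_ge0// sumr_ge0// => b _.
  by rewrite mulr_ge0// /ramp le_min ler01 le_max lexx.
- apply/measurable_EFinP; apply: continuous_measurable_fun.
  exact: (@continuous_step_cdf _ m w).
rewrite mulr_suml -sumEFin; apply: eq_bigr => a _.
transitivity ((v a)%:E * \int[lebesgue_measure]_(x in cell a)
    (w a * x + (\sum_(b < a) w b - w a * a%:R) / m%:R)%:E)%E; last first.
  rewrite integral_affine -?EFinM -?natr1; first by congr EFin; field.
  by rewrite ltr_pM2r ?invr_gt0// ltrDl.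
congr (_ * _)%E; apply: eq_integral => x.
rewrite inE/= in_itv/= ler_pdivrMr// ler_pdivlMr// => /andP[ax xa].
by rewrite (weighted_ramp_sum w (ltn_ord a) ax xa); congr EFin; field.
Qed.

End two_step_laws.

(** * Independent variables with prescribed laws *)

Lemma exists_independent_with_laws (R : realType) (n : nat)
    (mu : 'I_n -> probability (R : measurableType _) R) :
  exists (d : measure_display) (T : measurableType d) (P : probability T R)
         (X : 'I_n -> {RV P >-> R}),
    forall B : 'I_n -> set R, (forall i, measurable (B i)) ->
      P [set w | forall i, B i (X i w)] = (\prod_i mu i (B i))%E.
Proof.
(* Start from a one-point space, then adjoin one real factor at a time; the new variable, of index
   [ord0], is the second projection. *)
elim: n mu => [|n IH] mu.
  exists _, unit, (dirac tt : probability _ R).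
  unshelve eexists; first by case.
  move=> B _; rewrite big_ord0 (_ : [set _ | _] = setT) ?probability_setT//.
  by apply/seteqP; split => // w _ [].
have [d [T [P [X XE]]]] := IH (fun i => mu (lift ord0 i)).
pose P' : probability (T * R)%type R := (P \x mu ord0)%E.
pose X' (i : 'I_n.+1) (w : T * R) : R :=
  if unlift ord0 i is Some j then X j w.1 else w.2.
have mX' i : measurable_fun setT (X' i).
  rewrite /X'; case: unlift => [j|]; last exact: measurable_snd.
  exact: measurableT_comp measurable_fst.
exists _, (T * R)%type, P', (fun i => mfun_Sub (mem_set (mX' i))) => B mB.
rewrite big_ord_recl -XE; last by move=> i; exact: mB.
rewrite muleC -product_measure1E//; last first.
  rewrite (_ : [set _ | _] = \bigcap_(i in [set: 'I_n]) X i @^-1` B (lift ord0 i)).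
    apply: fin_bigcap_measurable => // i _.
    by rewrite -[X in measurable X]setTI; exact: measurable_funP.
  by apply/seteqP; split => w /= Bw i; [move=> _|]; exact: Bw.
congr (P' _); apply/seteqP; split => -[w x] /=.
  move=> Bw; split => [i|]; last by have := Bw ord0; rewrite /X' unlift_none.
  by have := Bw (lift ord0 i); rewrite /X' liftK.
by move=> [Bw B0] i; rewrite /X'; case: unliftP => [j|] ->.
Qed.

Section independent_laws.
Context d (T : measurableType d) (R : realType) (P : probability T R) (n : nat).
Context (X : 'I_n -> {RV P >-> R}).
Context (mu : 'I_n -> probability (R : measurableType _) R).
Hypothesis XE : forall B : 'I_n -> set R, (forall i, measurable (B i)) ->
  P [set w | forall i, B i (X i w)] = (\prod_i mu i (B i))%E.

(** Indices outside [J] are given the whole line, which contributes a factor 1. *)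
Lemma sub_family_law (J : {set 'I_n}) (B : 'I_n -> set R) :
  (forall i, measurable (B i)) ->
  P (\big[setI/setT]_(i in J) (X i @^-1` B i)) = (\prod_(i in J) mu i (B i))%E.
Proof.
move=> mB; pose B' i := if i \in J then B i else setT.
rewrite (_ : \big[_/_]_(i in J) _ = [set w | forall i, B' i (X i w)]).
  rewrite XE; last by move=> i; rewrite /B'; case: ifP.
  rewrite [RHS]big_mkcond/=; apply: eq_bigr => i _.
  by rewrite /B'; case: ifP => // _; rewrite probability_setT.
rewrite -bigcap_seq_cond; apply/seteqP; split => w Bw i /=.
  rewrite /B'; case: ifP => // iJ; apply: (Bw i).
  by rewrite /= mem_index_enum.
by move=> /andP[_ iJ]; have := Bw i; rewrite /B' iJ.
Qed.

Lemma coordinate_law i (B : set R) : measurable B -> P (X i @^-1` B) = mu i B.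
Proof.
move=> mB; have := @sub_family_law [set i] (fun=> B) (fun=> mB).
by rewrite !big_set1.
Qed.

Lemma laws_mutually_independent : mutually_independent X.
Proof.
move=> J B mB; rewrite sub_family_law//.
by apply: eq_bigr => i _; rewrite coordinate_law.
Qed.

(** The joint law agrees with the product measure on rectangles, which determine it. *)
Lemma pair_law i j (D : set (R * R)) : i != j -> measurable D ->
  P [set w | D (X i w, X j w)] = (mu i \x mu j)%E D.
Proof.
move=> ij mD; pose Y w := (X i w, X j w).
have mY : measurable_fun setT Y by exact: measurable_fun_pair.
rewrite (@product_measure_unique _ _ _ _ _ (mu i) (mu j)
  (distribution P (mfun_Sub (mem_set mY))))//.
move=> A B mA mB.
have := @sub_family_law [set i; j] (fun k => if k == i then A else B).
rewrite !big_setU1 ?inE//= !big_set1 eqxx eq_sym (negbTE ij); apply.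
by move=> k; case: ifP.
Qed.

Lemma order_law i j : i != j -> P [set w | X j w < X i w] =
  (\int[mu i]_x mu j `]-oo, x[%classic)%E.
Proof.
move=> ij; rewrite (@pair_law i j [set z | z.2 < z.1])//; last first.
  rewrite -[X in measurable X]setTI.
  exact: (measurable_fun_ltr measurable_snd measurable_fst).
rewrite /product_measure1; apply: eq_integral => x _ /=; congr (mu j _).
by apply/seteqP; split => y; rewrite /xsection/= ?in_itv/= ?inE.
Qed.

Lemma ge0_integral_law i (f : R -> \bar R) : measurable_fun setT f ->
  (forall x, 0 <= f x)%E -> (\int[P]_w f (X i w) = \int[mu i]_x f x)%E.
Proof.
move=> mf f0.
transitivity (\int[distribution P (X i)]_x f x)%E.
  by rewrite ge0_integral_distribution.
by apply: eq_measure_integral => A mA _; exact: coordinate_law.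
Qed.

Lemma expectation_law i : ('E_P[X i] =
  \int[mu i]_x (EFin ^\+ x) - \int[mu i]_x (EFin ^\- x))%E.
Proof.
rewrite expectation_def integralE -!ge0_integral_law//.
- by congr (_ - _)%E; apply: eq_integral => w _; rewrite ?funeposE ?funenegE.
- apply: measurable_funeneg; exact/measurable_EFinP.
- apply: measurable_funepos; exact/measurable_EFinP.
Qed.

End independent_laws.

(** * Block weights and the alternating form *)

Section block_weights.
Context (R : realType).
Implicit Types (k r a : nat) (u v : nat -> R).

(* Both rows are second differences, hence orthogonal to constants and to the
   identity; this makes distinct blocks orthogonal for the alternating form. *)
Definition block_e r : R := nth 0 [:: 1; - 2; 1; 0] r.
Definition block_f r : R := nth 0 [:: 0; 1; - 2; 1] r.

(** The density 1 + g / 4, where [u k] and [v k] are the coefficients in g of the k-th block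
    functions e and f. *)
Definition block_weight u v a : R :=
  1 + (u (a %/ 4)%N * block_e (a %% 4) + v (a %/ 4)%N * block_f (a %% 4)) / 4.

Lemma block_weightE u v k r : (r < 4)%N ->
  block_weight u v (4 * k + r) = 1 + (u k * block_e r + v k * block_f r) / 4.
Proof.
move=> r4.
by rewrite /block_weight mulnC divnMDl// modnMDl divn_small// modn_small// addn0.
Qed.

Lemma sum_block_weightD u v k r : (r <= 4)%N ->
  \sum_(a < 4 * k + r) block_weight u v a =
  \sum_(a < 4 * k) block_weight u v a +
  \sum_(a < r) (1 + (u k * block_e a + v k * block_f a) / 4).
Proof.
move=> r4; rewrite big_split_ord/=; congr (_ + _); apply: eq_bigr => a _.
by rewrite block_weightE// (leq_trans (ltn_ord a)).
Qed.

Lemma sum_block_weight u v k :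
  \sum_(a < 4 * k) block_weight u v a = (4 * k)%:R.
Proof.
elim: k => [|k IH]; first by rewrite muln0 big_ord0.
rewrite mulnS addnC sum_block_weightD// IH natrD; congr (_ + _).
by rewrite !big_ord_recr big_ord0 /block_e /block_f/=; lra.
Qed.

(** The perturbations have zero sum and zero first moment, so the value is that for constant weight
    1. *)
Lemma sum_block_weight_mid u v k :
  \sum_(a < 4 * k) block_weight u v a * (a%:R + 2^-1) = (4 * k)%:R ^+ 2 / 2.
Proof.
elim: k => [|k IH]; first by rewrite muln0 big_ord0; lra.
rewrite mulnS addnC big_split_ord/= IH natrD.
under eq_bigr do rewrite block_weightE// natrD.
set x := (4 * k)%:R; move: x => x.
by rewrite !big_ord_recr big_ord0 /block_e /block_f/=; field.
Qed.

(** Blocks before the k-th enter only through their total [4 * k], so distinct blocks do not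
    interact. Within a block the linear terms vanish, and the form takes the value -1 on (e, f), 1
    on (f, e) and 0 on (e, e) and (f, f); the 16 is the square of the scale 4. *)
Lemma sum_block_weight_win u v u' v' k :
  \sum_(a < 4 * k) block_weight u v a *
    (\sum_(b < a) block_weight u' v' b + block_weight u' v' a / 2) =
  (4 * k)%:R ^+ 2 / 2 + (\sum_(j < k) (v j * u' j - u j * v' j)) / 16.
Proof.
elim: k => [|k IH]; first by rewrite muln0 !big_ord0; lra.
rewrite mulnS addnC big_split_ord/= IH natrD [in RHS]big_ord_recr/=.
set s := \sum_(j < k) _.
rewrite (eq_bigr (fun r : 'I_4 => (1 + (u k * block_e r + v k * block_f r) / 4) *
  ((4 * k)%:R + \sum_(b < r) (1 + (u' k * block_e b + v' k * block_f b) / 4) +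
   (1 + (u' k * block_e r + v' k * block_f r) / 4) / 2))) => [|r _]; last first.
  rewrite (block_weightE u v k (ltn_ord r)) (block_weightE u' v' k (ltn_ord r)).
  by rewrite (sum_block_weightD u' v' k (ltnW (ltn_ord r))) sum_block_weight.
move: (4 * k)%:R s => x s.
by rewrite !big_ord_recr !big_ord0 /block_e /block_f/=; field.
Qed.

(** The entries of both rows are at most 2 in absolute value, so the perturbation is at most 2/4. *)
Lemma block_weight_ge u v a : `|u (a %/ 4)%N| + `|v (a %/ 4)%N| <= 1 ->
  2^-1 <= block_weight u v a.
Proof.
rewrite /block_weight; set x := u _; set y := v _.
move: (a %% 4)%N (ltn_pmod a (isT : 0 < 4)%N) => r.
move: (ler_norm x) (ler_norm (- x)) (ler_norm y) (ler_norm (- y)).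
rewrite !normrN /block_e /block_f.
by case: r => [|[|[|[|//]]]] ? ? ? ? _ /= ?; lra.
Qed.

End block_weights.

Unset Implicit Arguments.

Theorem theorem1p2 (R : realType) (n : nat) (Rel : rel 'I_n) :
  tournament Rel ->
  exists (d : measure_display) (T : measurableType d) (P : probability T R)
         (X : 'I_n -> {RV P >-> R}),
    mutually_independent X /\
    (forall i, continuous_unit_rv (X i) /\ proper_rv (X i)) /\
    (forall i j : 'I_n,
       ((2^-1 : R)%:E < P [set w | (X j w < X i w)%R])%E <-> Rel i j).
Proof.
move=> [irr asym].
(* [u i] selects e_i, and [v i] selects the f_k with [k] beaten by [i]. Weights are indexed by
   naturals, so [v i] defaults to 0 beyond the vertices. *)
pose u (i : 'I_n) (k : nat) : R := (k == i)%:R.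
pose v (i : 'I_n) (k : nat) : R := oapp (fun j => (Rel i j)%:R) 0 (insub k).
have vE (i j : 'I_n) : v i j = (Rel i j)%:R by rewrite /v valK.
have W i a : 2^-1 <= block_weight (u i) (v i) a.
  apply: block_weight_ge; rewrite /u.
  (* Since [Rel] has no loops, e_i and f_i never both occur in g_i, which gives the bound required
     by [block_weight_ge]. *)
  have [->|_] := eqVneq; first by rewrite vE (negbTE (irr i)) normr1 normr0 addr0.
  rewrite normr0 add0r /v; case: insub => [j|]/=; last by rewrite normr0.
  by case: (Rel i j); rewrite ?normr1 ?normr0.
have W0 i a : 0 <= block_weight (u i) (v i) a by rewrite (le_trans _ (W i a)).
(* The case [n = 0] is allowed, so positivity is drawn from a vertex [i]. *)
have n4 (i : 'I_n) : (0 < 4 * n)%N by rewrite muln_gt0 (leq_trans _ (ltn_ord i)).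
pose mu i := step_law (n4 i) (W0 i) (sum_block_weight (u i) (v i) n).
have [d [T [P [X XE]]]] := exists_independent_with_laws mu.
exists d, T, P, X; split; first exact: laws_mutually_independent XE.
have m0 (i : 'I_n) : (4 * n)%:R != 0 :> R by rewrite pnatr_eq0 -lt0n n4.
split => [i|i j].
  have FE : distr_fun (X i) = step_cdf (4 * n) (block_weight (u i) (v i)).
    apply/funext => x; rewrite /distr_fun /cdf /distribution /pushforward.
    by rewrite (coordinate_law XE)// /mu step_law_itv.
  split.
    rewrite /continuous_unit_rv FE; split; first exact: continuous_step_cdf.
    split; first by apply: step_cdf_increasing (W i) => //; exact: n4 i.
    by rewrite step_cdf0 step_cdf1 ?sum_block_weight// n4.
  rewrite /proper_rv (expectation_law XE) step_law_mean sum_block_weight_mid.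
  by rewrite mulrAC divff ?expf_neq0 ?m0// mul1r.
have [<-|ij] := eqVneq i j.
  rewrite (_ : [set _ | _] = set0) ?measure0; last first.
    by apply/seteqP; split => w //=; rewrite ltxx.
  by rewrite (negbTE (irr i)) lte_fin ltNge invr_ge0 ler0n.
(* Both laws must carry the same positivity proof for [step_law_order] to apply. *)
rewrite (order_law XE ij) /mu (bool_irrelevance (n4 j) (n4 i)).
rewrite step_law_order sum_block_weight_win.
(* As [u i] and [u j] are indicators, only the terms at [j] and at [i] survive. *)
have -> : \sum_(k < n) (v i k * u j k - u i k * v j k) =
    (Rel i j)%:R - (Rel j i)%:R.
  rewrite sumrB (bigD1 j)//= big1 ?addr0 => [|k kj]; last first.
    by rewrite /u val_eqE (negbTE kj) mulr0.
  rewrite (bigD1 i)//= big1 ?addr0 => [|k ki]; last first.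
    by rewrite /u val_eqE (negbTE ki) mul0r.
  by rewrite /u !eqxx mulr1 mul1r !vE.
have m2 : 0 < (4 * n)%:R ^+ 2 :> R by rewrite exprn_gt0// ltr0n n4.
rewrite lte_fin ltr_pdivlMr// mulrC ltrDl pmulr_lgt0 ?invr_gt0//.
(* The excess over 1/2 has the sign of this difference, which is 1 or -1. *)
have := asym i j ij.
by case: (Rel i j) (Rel j i) => -[]//= _; rewrite ?subr0 ?ltr01// sub0r oppr_gt0 ltr10.
Qed.
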